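(* Let $K$ be a field of arbitrary characteristic and let $R=\bigoplus_{n\geq 0}R_n$ be a finitely generated graded associative $K$-algebra with $R_0=0$ or $R_0=K$. If $R$ is a PI-algebra (i.e. $R$ satisfies a nontrivial polynomial identity), then the Hilbert series $H(R,t)=\sum_{n\geq 0}\dim_K(R_n)t^n$ is either rational or transcendental over $\mathbb{Q}(t)$; that is, if $H(R,t)$ is algebraic over $\mathbb{Q}(t)$, then it is a rational function in $\mathbb{Q}(t)$.
   Context: A $K$-algebra $R$ is graded if it is a direct sum of vector subspaces $R_0,R_1,R_2,\ldots$ (its homogeneous components) with $R_mR_n\subset R_{m+n}$ for all $m,n\geq 0$. It is assumed that $R_0=0$ or $R_0=K$; for a finitely generated $R$ all the components $R_n$ are then finite dimensional. The Hilbert series of $R$ is the formal power series $H(R,t)=\sum_{n\geq 0}\dim_K(R_n)t^n$. An element $f(x_1,\ldots,x_n)$ of the free associative algebra $K\langle x_1,x_2,\ldots\rangle$ is a polynomial identity for $R$ if $f(r_1,\ldots,r_n)=0$ for all $r_1,\ldots,r_n\in R$ (if $R$ is not unital, $f$ is taken without constant term). The algebra $R$ is a PI-algebra if it satisfies a polynomial identity $f\neq 0$. A power series $a(t)$ is rational if it is (the expansion at $0$ of) an element of $\mathbb{Q}(t)$, algebraic if $p(t,a(t))=0$ for some nonzero polynomial $p(t,z)\in\mathbb{Q}[t,z]$, and transcendental if it is not algebraic. *)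

(* Defs.v *)
From HB Require Import structures.
From mathcomp Require Import all_boot all_order all_algebra.
From mathcomp Require Import finmap.
From mathcomp.multinomials Require Import monalg.
From mathcomp Require Import boolp classical_sets.

Set Implicit Arguments.
Unset Strict Implicit.
Unset Printing Implicit Defensive.

Import GRing.Theory.
Local Open Scope ring_scope.

Section Algebras.
Variables (K : fieldType) (R : lmodType K) (mul : R -> R -> R).

(* MathComp rings are unital, while an algebra with R_0 = 0 usually is not:
   an associative algebra is a vector space R with a bilinear associative
   product mul, and a unit is not part of the structure. *)
Definition assoc_algebra : Prop :=
  bilinear_for *:%R *:%R mul /\ associative mul.

Definition is_unity (e : R) : Prop := left_id e mul /\ right_id e mul.

(* The generated subalgebra is taken without adjoining a unit; for unital R
   this gives the same notion of finite generation, since the unit may be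
   listed among the generators. *)
Definition finitely_generated : Prop :=
  exists s : seq R, forall S : {pred R},
    GRing.submod_closed S -> {in S &, forall x y, mul x y \in S} ->
    {subset s <= S} -> forall x, x \in S.

Record grading (Rn : nat -> {pred R}) : Prop := Grading {
  grading_subspace : forall n, GRing.submod_closed (Rn n);
  grading_span : forall x : R, exists (n : nat) (c : nat -> R),
    (forall i, c i \in Rn i) /\ x = \sum_(i < n) c i;
  grading_direct : forall (n : nat) (c : nat -> R),
    (forall i, c i \in Rn i) -> \sum_(i < n) c i = 0 ->
    forall i, (i < n)%N -> c i = 0;
  grading_mul : forall m n x y,
    x \in Rn m -> y \in Rn n -> mul x y \in Rn (m + n)%N
}.

(* "R_0 = K" means that R has a unit 1 <> 0 and R_0 = K 1. *)
Definition connected (Rn : nat -> {pred R}) : Prop :=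
  (forall x, x \in Rn 0%N <-> x = 0) \/
  (exists e : R, [/\ is_unity e, e <> 0 &
     forall x, x \in Rn 0%N <-> exists a : K, x = a *: e]).


(* {malg K[{fmonom nat}]} is the free associative algebra K<x_0, x_1, ...>.
   The value of the word w at r; e is the value of the empty word. *)
Definition word_eval (e : R) (r : nat -> R) (w : seq nat) : R :=
  if w is i :: w' then foldl (fun x j => mul x (r j)) (r i) w' else e.

Definition free_eval (e : R) (r : nat -> R) (f : {malg K[{fmonom nat}]}) : R :=
  \sum_(w <- msupp f) f@_w *: word_eval e r w.

(* In the second clause e = 0 is a dummy value: f has no constant term. *)
Definition polynomial_identity (f : {malg K[{fmonom nat}]}) : Prop :=
  (forall e, is_unity e -> forall r, free_eval e r f = 0) /\
  (~ (exists e, is_unity e) ->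
     f@_mone = 0 /\ forall r, free_eval 0 r f = 0).

Definition PI_algebra : Prop :=
  exists f : {malg K[{fmonom nat}]}, f != 0 /\ polynomial_identity f.

End Algebras.

Section Hilbert.
Variables (K : fieldType) (R : lmodType K).

Definition has_dim (V : {pred R}) (d : nat) : Prop :=
  exists b : 'I_d -> R,
    [/\ forall i, b i \in V,
        forall c : 'I_d -> K, \sum_i c i *: b i = 0 -> forall i, c i = 0 &
        forall x, x \in V -> exists c : 'I_d -> K, x = \sum_i c i *: b i].

(* 0 when V is infinite dimensional, which does not occur for the homogeneous
   components of the algebras considered here. *)
Definition dim (V : {pred R}) : nat := xget 0%N [set d | has_dim V d].

Definition hilbert_series (Rn : nat -> {pred R}) : nat -> rat :=
  fun n => (dim (Rn n))%:R.

End Hilbert.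

(* A formal power series over Q is identified with its coefficient sequence. *)
Definition series_mul (a b : nat -> rat) : nat -> rat :=
  fun n => \sum_(i < n.+1) a i * b (n - i)%N.

Definition series_exp (a : nat -> rat) (k : nat) : nat -> rat :=
  iter k (series_mul a) (fun n => (n == 0%N)%:R).

Definition series_of_poly (p : {poly rat}) : nat -> rat := fun n => p`_n.

(* p is a polynomial in z with coefficients in Q[t]; this is p(t, a(t)). *)
Definition series_subst (p : {poly {poly rat}}) (a : nat -> rat) : nat -> rat :=
  fun n => \sum_(k < size p)
    series_mul (series_of_poly p`_k) (series_exp a k) n.

(* a is the expansion at 0 of p / q, where q(0) <> 0. *)
Definition rational_series (a : nat -> rat) : Prop :=
  exists p q : {poly rat},
    q.[0] != 0 /\ series_mul (series_of_poly q) a =1 series_of_poly p.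

Definition algebraic_series (a : nat -> rat) : Prop :=
  exists p : {poly {poly rat}}, p != 0 /\ series_subst p a =1 (fun _ => 0).

Definition transcendental_series (a : nat -> rat) : Prop :=
  ~ algebraic_series a.

(* Main.v *)
(** Write [a_n = dim R_n].  A multilinear identity of degree [d] rewrites a
    product [u_1 ... u_d] of words as a combination of its nontrivial
    permutations, so [R_n] is spanned by words in homogeneous generators that
    are not products [p u_1 ... u_d] whose factors [u_i] have strictly
    decreasing prefixes of length [m].  Cut such a word into blocks of length
    [m]: the sequence of blocks has no strictly decreasing subsequence of
    length [d], hence it is a union of [d - 1] weakly increasing sequences, and
    for fixed [m] there are at most [poly(n) d^(n/m)] of them.  As [m] is
    arbitrary, [a_n] grows subexponentially, so Shirshov's height theorem is
    not needed.

    The second half is Fatou's argument.  If [p(t, a(t)) = 0] and [c(t)] is the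
    leading coefficient of [p], then [b = c a] is integral over [Q[t]], hence
    bounded on the open unit disc, where the series converges.  By Parseval
    [sum b_n^2] is finite; the [b_n] have a common denominator, so [b] is a
    polynomial and [a = b / c].  Convergence is avoided by truncating [a] at
    large order, and circle averages by averages over roots of unity. *)
Require Import Defs.
From mathcomp Require Import all_boot all_order all_algebra all_field.
From mathcomp Require Import finmap.
From mathcomp.multinomials Require Import monalg.
From mathcomp Require Import boolp classical_sets.
From mathcomp Require Import zify ring lra.

Set Implicit Arguments.
Unset Strict Implicit.
Unset Printing Implicit Defensive.

Import Order.TTheory GRing.Theory Num.Theory.

(** * Words without long chains of decreasing blocks *)

Section Rank.
Variable b : nat -> nat.

(* [descent_rank i] is the largest number of terms preceding [b i] in a strictly
   decreasing subsequence that ends with [b i]. *)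
Fixpoint descent_ranks n : seq nat :=
  if n is n'.+1 then
    rcons (descent_ranks n')
      (\max_(j < n' | b n' < b j) (nth 0 (descent_ranks n') j).+1)
  else [::].

Definition descent_rank i := nth 0 (descent_ranks i.+1) i.

Lemma size_descent_ranks n : size (descent_ranks n) = n.
Proof. by elim: n => //= n IH; rewrite size_rcons IH. Qed.

Lemma nth_descent_ranks n i :
  i < n -> nth 0 (descent_ranks n) i = descent_rank i.
Proof.
elim: n => // n IH; rewrite ltnS leq_eqVlt => /predU1P[-> //|lt_in].
by rewrite /= nth_rcons size_descent_ranks lt_in IH.
Qed.

Lemma descent_rankE i :
  descent_rank i = \max_(j < i | b i < b j) (descent_rank j).+1.
Proof.
rewrite /descent_rank /= nth_rcons size_descent_ranks ltnn eqxx.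
by apply: eq_bigr => j _; rewrite nth_descent_ranks.
Qed.

Lemma descent_rank_lt i j :
  j < i -> b i < b j -> descent_rank j < descent_rank i.
Proof.
move=> ji bij; rewrite [descent_rank i]descent_rankE.
exact: (@leq_bigmax_cond _ _ (fun j : 'I_i => (descent_rank j).+1) (Ordinal
  ji)).
Qed.

Lemma descent_rank_pred k i : k < descent_rank i ->
  exists j, [/\ j < i, b i < b j & k <= descent_rank j].
Proof.
rewrite descent_rankE ltnNge => /bigmax_leqP h.
have [j /andP[bij kj]|none] := pickP (fun j : 'I_i => (b i < b j) && (k <=
  descent_rank j)).
  by exists j; split.
case: h => j bij; have := none j; rewrite bij /= => /negbT.
by rewrite -ltnNge.
Qed.
End Rank.

(** * Numerical values of words, and words that are normal for blocks of length [m] *)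

Section Words.
Variable l : nat.
Implicit Types u v w : seq 'I_l.

(* Base-[l] value: on words of the same length its order is the lexicographic
   one. *)
Definition word_num w := foldl (fun a (i : 'I_l) => a * l + i) 0 w.

Lemma word_num_rcons w i : word_num (rcons w i) = word_num w * l + i.
Proof. by rewrite /word_num foldl_rcons. Qed.

Lemma word_num_cat u v : word_num (u ++ v) = word_num u * l ^ size v + word_num
  v.
Proof.
elim/last_ind: v => [|v i IH]; first by rewrite cats0 muln1 addn0.
by rewrite -rcons_cat !word_num_rcons IH size_rcons expnSr; lia.
Qed.

Lemma word_num_lt v : word_num v < l ^ size v.
Proof.
elim/last_ind: v => // v i IH; rewrite word_num_rcons size_rcons expnSr.
apply: leq_trans (_ : (word_num v).+1 * l <= _);
  last by rewrite leq_mul2r IH orbT.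
by rewrite mulSn addnC ltn_add2r.
Qed.

Lemma word_num_inj u v : size u = size v -> word_num u = word_num v -> u = v.
Proof.
elim/last_ind: u v => [|u i IH] v; first by case: v.
case/lastP: v => [|v j]; rewrite !size_rcons // => -[suv].
have l0 : 0 < l by apply: leq_ltn_trans (ltn_ord i).
rewrite !word_num_rcons => /(congr1 (fun n => (n %/ l, n %% l))).
rewrite !divnMDl // !modnMDl !divn_small // !modn_small // !addn0 => -[uv ij].
by rewrite (IH v) // (ord_inj ij).
Qed.

Lemma word_num_cat_lt u u' v v' : size v = size v' -> word_num u < word_num u'
  ->
  word_num (u ++ v) < word_num (u' ++ v').
Proof.
move=> sv lt_u; rewrite !word_num_cat -sv.
apply: leq_trans (_ : (word_num u).+1 * l ^ size v <= _).
  by rewrite mulSn addnC ltn_add2r word_num_lt.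
by apply: leq_trans (leq_addr _ _); rewrite leq_mul2r lt_u orbT.
Qed.

Variable m : nat.

Definition word_key w := word_num (take m w).

Lemma size_flatten_perm us vs : perm_eq us vs ->
  size (flatten us : seq 'I_l) = size (flatten vs).
Proof. by move=> uvs; apply/perm_size/perm_flatten. Qed.

(** At the first place where [vs] differs from [us] it has a factor that occurs later in [us], hence
    one with a smaller key. All factors have length at least [m], so the first [m] letters at that
    place decide the comparison. *)
Lemma word_num_flatten_lt (us vs : seq (seq 'I_l)) :
  all (fun u => m <= size u) us -> sorted gtn (map word_key us) ->
  perm_eq vs us -> vs != us -> word_num (flatten vs) < word_num (flatten us).
Proof.
elim: us vs => [|u us IH] vs; first by move=> _ _ /perm_nilP->.
case: vs => [|v vs] /=; first by move=> _ _ /perm_size.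
move=> /andP[mu mus] srt pvu; case: (eqVneq v u) pvu => [-> | neq_vu pvu _].
  rewrite perm_cons eqseq_cons eqxx /= => pvu neq_vs.
  rewrite !word_num_cat (size_flatten_perm pvu) ltn_add2l.
  by apply: IH => //; apply: path_sorted srt.
have v_us : v \in us.
  by have := perm_mem pvu v; rewrite !inE eqxx (negPf neq_vu).
have mv : m <= size v by apply: (allP mus).
have key_lt : word_key v < word_key u.
  have/allP := order_path_min (rev_trans ltn_trans) srt.
  by move=> /(_ (word_key v)); apply; apply: map_f.
have -> : v ++ flatten vs = take m v ++ (drop m v ++ flatten vs).
  by rewrite catA cat_take_drop.
have -> : u ++ flatten us = take m u ++ (drop m u ++ flatten us).
  by rewrite catA cat_take_drop.
apply: word_num_cat_lt => //; have := size_flatten_perm pvu.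
by rewrite /= !size_cat !size_drop; lia.
Qed.

Hypothesis m_gt0 : 0 < m.

Definition word_block w i := take m (drop (i * m) w).
Definition block_num w i := word_num (word_block w i).
Definition nb_blocks w := size w %/ m.

(** A block of rank [d] ends a strictly decreasing chain of [d.+1] blocks, so [d] is one less than
    the degree of the identity used for rewriting. Only complete blocks are tested. *)
Definition normal_word d w :=
  all (fun i => descent_rank (block_num w) i < d) (iota 0 (nb_blocks w)).

(** Each factor runs from the start of one block of a decreasing chain to the start of the next, so
    its key is the number of its first block. The final block [i] stays outside the factors, which
    lets the induction on [k] append one factor at the end. *)
Lemma rank_chain w i k :
  k <= descent_rank (block_num w) i -> i * m <= size w ->
  exists p us, [/\ take (i * m) w = p ++ flatten us, size us = k,
    all (fun u => m <= size u) us &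
    sorted gtn (rcons (map word_key us) (block_num w i))].
Proof.
elim: k i => [|k IH] i; first by exists (take (i * m) w), [::]; rewrite cats0.
move=> /descent_rank_pred[j [ji lt_b kj]] iw.
have jim : j * m <= i * m by rewrite leq_mul2r (ltnW ji) orbT.
have [p [us [def_p sus mus srt]]] := IH j kj (leq_trans jim iw).
have jm : j * m + m <= i * m by rewrite -mulSnr leq_mul2r ji orbT.
pose u := drop (j * m) (take (i * m) w).
have key_u : word_key u = block_num w j.
  rewrite /word_key /u /block_num /word_block -[i * m](subnK jim) -take_drop.
  by rewrite take_takel // leq_subRL.
exists p, (rcons us u); split.
- rewrite flatten_rcons catA -def_p -(take_takel w jim).
  by rewrite cat_take_drop.
- by rewrite size_rcons sus.
- by rewrite all_rcons mus andbT /u size_drop size_takel // leq_subRL.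
- rewrite map_rcons key_u; case: (map word_key us) srt => [|x K] /= => [_|srt].
    by rewrite lt_b.
  by rewrite rcons_path srt last_rcons.
Qed.

Lemma not_normalP d w : ~~ normal_word d w -> exists p us,
  [/\ w = p ++ flatten us, size us = d.+1,
      all (fun u => m <= size u) us & sorted gtn (map word_key us)].
Proof.
move=> /allPn[i]; rewrite mem_iota add0n -leqNgt /= => lt_i d_le.
have imw : i * m + m <= size w.
  by rewrite -mulSnr; apply: leq_trans (leq_divM (size w) m);
    rewrite leq_mul2r lt_i orbT.
have [p [us [def_p sus mus srt]]] := rank_chain d_le (leq_trans (leq_addr _ _)
  imw).
(* The last factor runs from the block of too large rank to the end of [w]. *)
exists p, (rcons us (drop (i * m) w)); split.
- by rewrite flatten_rcons catA -def_p cat_take_drop.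
- by rewrite size_rcons sus.
- by rewrite all_rcons mus andbT size_drop leq_subRL // (leq_trans (leq_addr _
  _) imw).
- by rewrite map_rcons.
Qed.

(* Blocks of equal rank form a weakly increasing sequence, so they are
   determined by their positions and the multiplicity of each value. *)
Definition color_count w (c x : nat) :=
  count_mem x [seq block_num w i | i <- iota 0 (nb_blocks w)
    & descent_rank (block_num w) i == c].

Lemma blocks_inj d w w' : normal_word d w -> size w = size w' ->
  (forall i, i < nb_blocks w ->
     descent_rank (block_num w) i = descent_rank (block_num w') i) ->
  (forall c x, c < d -> x < l ^ m -> color_count w c x = color_count w' c x) ->
  forall i, i < nb_blocks w -> word_block w i = word_block w' i.
Proof.
move=> nw sww eq_rank eq_count i lt_i.
have size_block v j : size v = size w -> j < nb_blocks w -> size (word_block v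
  j) = m.
  move=> sv lt_j; rewrite size_takel // size_drop sv leq_subRL.
    by rewrite -mulSnr; apply: leq_trans (leq_divM (size w) m);
      rewrite leq_mul2r lt_j orbT.
  by apply: leq_trans (leq_divM (size w) m); rewrite leq_mul2r ltnW ?orbT.
have eq_n : nb_blocks w' = nb_blocks w by rewrite /nb_blocks sww.
apply: word_num_inj; first by rewrite !size_block.
set c := descent_rank (block_num w) i.
have lt_cd : c < d by have/allP := nw; apply; rewrite mem_iota.
have filt_eq : [seq j <- iota 0 (nb_blocks w') | descent_rank (block_num w') j
  == c]
    = [seq j <- iota 0 (nb_blocks w) | descent_rank (block_num w) j == c].
  rewrite eq_n; apply: eq_in_filter => j; rewrite mem_iota => /andP[_ lt_j].
  by rewrite eq_rank.
(* A strict drop between two positions would make the later rank larger than the earlier one, so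
   equal ranks force a weakly increasing sequence. Such a sequence is determined by its multiset of
   values. *)
have srt v : sorted leq [seq block_num v j | j <- iota 0 (nb_blocks v)
    & descent_rank (block_num v) j == c].
  rewrite sorted_map; apply: (@sub_in_sorted _ (fun j => descent_rank
    (block_num v) j == c) ltn).
  - move=> j k /eqP rj /eqP rk lt_jk /=.
    rewrite leqNgt; apply/negP => lt_b.
    by have := descent_rank_lt (b := block_num v) lt_jk lt_b;
      rewrite rj rk ltnn.
  - by apply/allP => j; rewrite mem_filter => /andP[].
  - by apply: sorted_filter; [apply: ltn_trans | apply: iota_ltn_sorted].
have num_lt_lm v j : size v = size w -> j < nb_blocks w -> block_num v j < l ^
  m.
  by move=> sv lt_j; rewrite -(size_block v j sv lt_j) word_num_lt.
have := sorted_eq leq_trans anti_leq (srt w) (srt w').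
rewrite filt_eq => /(_ _)/eq_in_map; apply; last first.
  by rewrite mem_filter eqxx mem_iota.
have eq_cnt x : x < l ^ m -> count_mem x [seq block_num w j | j <- iota 0
  (nb_blocks w)
      & descent_rank (block_num w) j == c] =
    count_mem x [seq block_num w' j | j <- iota 0 (nb_blocks w)
      & descent_rank (block_num w) j == c].
  by move=> lt_x; have := eq_count c x lt_cd lt_x; rewrite /color_count filt_eq.
apply/allP => x; rewrite mem_cat => /orP[] /mapP[j];
  rewrite mem_filter mem_iota => /and3P[_ _ lt_j] -> /=; apply/eqP/eq_cnt;
  exact: num_lt_lm.
Qed.

Lemma word_eq_blocks w w' : size w = size w' ->
  (forall i, i < nb_blocks w -> word_block w i = word_block w' i) ->
  drop (nb_blocks w * m) w = drop (nb_blocks w * m) w' -> w = w'.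
Proof.
move=> sww eq_b eq_d; rewrite -(cat_take_drop (nb_blocks w * m) w) eq_d.
rewrite -[RHS](cat_take_drop (nb_blocks w * m)); congr (_ ++ _).
have: nb_blocks w <= nb_blocks w by [].
elim: {1 3 4}(nb_blocks w) => [|k IH] lt_k; first by rewrite !take0.
by rewrite mulSnr !takeD IH ?(ltnW lt_k) // -/(word_block w k) -/(word_block w'
  k) eq_b.
Qed.

(** The components are the length, the ranks of the blocks, the multiplicities by rank and value,
    and the incomplete last block. For fixed [m] only the ranks have exponentially many
    possibilities in [n], with exponent [n %/ m]. *)
Definition word_code d n w :
  'I_n.+1 * {ffun 'I_(n %/ m) -> 'I_d.+1} *
  {ffun 'I_d.+1 * 'I_(l ^ m).+1 -> 'I_n.+1} * {bseq m of 'I_l} :=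
  (inord (size w),
   [ffun i : 'I_(n %/ m) => inord (descent_rank (block_num w) i)],
   [ffun cx : 'I_d.+1 * 'I_(l ^ m).+1 => inord (color_count w cx.1 cx.2)],
   insub_bseq m (drop (nb_blocks w * m) w)).

Lemma word_code_inj d n w w' : normal_word d w -> normal_word d w' ->
  size w <= n -> size w' <= n -> word_code d n w = word_code d n w' -> w = w'.
Proof.
move=> nw nw' sw sw' [/(congr1 val) /=]; rewrite !inordK // => ssw.
move=> /ffunP eq_r /ffunP eq_c eq_d.
have nbw : nb_blocks w' = nb_blocks w by rewrite /nb_blocks ssw.
have nb_le : nb_blocks w <= n %/ m by apply: leq_div2r.
have nb_n : nb_blocks w <= n by apply: leq_trans sw; apply: leq_div.
apply: word_eq_blocks => //.
  apply: (blocks_inj nw) => // [i lt_i | c x lt_c lt_x].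
    have := eq_r (Ordinal (leq_trans lt_i nb_le)); rewrite !ffunE.
    have r_lt : descent_rank (block_num w) i < d by apply: (allP nw);
      rewrite mem_iota.
    have r_lt' : descent_rank (block_num w') i < d.
      by apply: (allP nw'); rewrite mem_iota /= nbw.
    by move=> /(congr1 val) /=; rewrite !inordK // ltnS ltnW.
  have := eq_c (Ordinal (ltnW lt_c : c < d.+1), Ordinal (ltnW lt_x : x < (l ^
    m).+1)).
  rewrite !ffunE /= => /(congr1 val) /=; rewrite !inordK // ltnS /color_count.
    apply: leq_trans (count_size _ _) _; rewrite size_map size_filter.
    by apply: leq_trans (count_size _ _) _; rewrite size_iota nbw.
  apply: leq_trans (count_size _ _) _; rewrite size_map size_filter.
  by apply: leq_trans (count_size _ _) _; rewrite size_iota.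
have szd v : size v = size w -> size (drop (nb_blocks w * m) v) <= m.
  by move=> sv; rewrite size_drop sv {1}(divn_eq (size w) m) addKn ltnW //
    ltn_mod.
have := congr1 val eq_d; rewrite nbw /insub_bseq !val_insubd !szd //.
Qed.

Lemma normal_words_count d : exists C D, forall n (W : seq (seq 'I_l)),
  uniq W -> (forall w, w \in W -> size w <= n /\ normal_word d w) ->
  size W <= C * n.+1 ^ D * d.+1 ^ (n %/ m).
Proof.
(* The exponent counts one multiplicity for each pair of rank and block value, plus one for the
   length. *)
exists #|{bseq m of 'I_l}|, (d.+1 * (l ^ m).+1).+1 => n W uW hW.
have inj : {in W &, injective (word_code d n)}.
  by move=> w w' /hW[? ?] /hW[? ?]; apply: word_code_inj.
rewrite -(size_map (word_code d n)).
have /card_uniqP <- : uniq (map (word_code d n) W) by rewrite map_inj_in_uniq.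
apply: leq_trans (max_card _) _.
rewrite !card_prod !card_ffun !card_prod !card_ord expnS.
move: (_ ^ (d.+1 * _)) (d.+1 ^ _) #|_| => x y z; lia.
Qed.

End Words.

Local Open Scope ring_scope.

(** * Integral algebraic series of subexponential growth *)

Definition series_trunc (a : nat -> rat) (N : nat) : {poly rat} :=
  \poly_(i < N) a i.

Lemma coef_series_exp (a : nat -> rat) (N k n : nat) : (n < N)%N ->
  (series_trunc a N ^+ k)`_n = series_exp a k n.
Proof.
elim: k n => [|k IH] n nN; first by rewrite expr0 coef1.
rewrite exprS coefM /series_exp iterS /series_mul; apply: eq_bigr => i _.
have iN : (i < N)%N by apply: leq_ltn_trans nN; rewrite -ltnS.
by rewrite IH ?coef_poly ?iN //; apply: leq_ltn_trans (leq_subr _ _) nN.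
Qed.

Lemma coef_series_subst (p : {poly {poly rat}}) (a : nat -> rat) (N n : nat) :
  (n < N)%N -> (p.[series_trunc a N])`_n = series_subst p a n.
Proof.
move=> nN; rewrite horner_coef coef_sum; apply: eq_bigr => k _.
rewrite coefM; apply: eq_bigr => i _.
by rewrite coef_series_exp //; apply: leq_ltn_trans (leq_subr _ _) nN.
Qed.

Lemma coef_mul_trunc (q : {poly rat}) (a : nat -> rat) (N n : nat) :
  (n < N)%N -> (q * series_trunc a N)`_n = series_mul (series_of_poly q) a n.
Proof.
move=> nN; rewrite coefM; apply: eq_bigr => i _.
by rewrite coef_poly (leq_ltn_trans (leq_subr _ _) nN).
Qed.

(** * The sum of absolute values of coefficients as a submultiplicative norm *)

Definition l1_norm (f : {poly rat}) : rat := \sum_(i < size f) `|f`_i|.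

Lemma l1_wide (f : {poly rat}) n : (size f <= n)%N ->
  l1_norm f = \sum_(i < n) `|f`_i|.
Proof.
move=> le_fn; rewrite /l1_norm (big_ord_widen n (fun i => `|f`_i|)) //
  [RHS](bigID (fun i : 'I_n => (i < size f)%N)) /=.
rewrite [X in _ = _ + X]big1 ?addr0 // => i.
by rewrite -leqNgt => ?; rewrite nth_default // normr0.
Qed.

Lemma l1_ge0 f : 0 <= l1_norm f.
Proof. by apply: sumr_ge0. Qed.

Lemma l1D f g : l1_norm (f + g) <= l1_norm f + l1_norm g.
Proof.
set n := maxn (size f) (size g).
rewrite (@l1_wide _ n) ?size_polyD // (@l1_wide f n) ?leq_maxl //.
rewrite (@l1_wide g n) ?leq_maxr // -big_split /=.
by apply: ler_sum => i _; rewrite coefD ler_normD.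
Qed.

Lemma l1_sum n (F : 'I_n -> {poly rat}) :
  l1_norm (\sum_(i < n) F i) <= \sum_(i < n) l1_norm (F i).
Proof.
elim/big_rec2: _ => [|i y x _ le_yx];
  first by rewrite /l1_norm size_poly0 big_ord0.
by apply: le_trans (l1D _ _) _; rewrite lerD2l.
Qed.

Lemma l1Z c f : l1_norm (c *: f) = `|c| * l1_norm f.
Proof.
rewrite (@l1_wide _ (size f)) ?size_scale_leq // /l1_norm mulr_sumr.
by apply: eq_bigr => i _; rewrite coefZ normrM.
Qed.

Lemma l1_MXaddC f c : l1_norm (f * 'X + c%:P) = l1_norm f + `|c|.
Proof.
rewrite (@l1_wide _ (size f).+1); last first.
  by rewrite size_MXaddC; case: ifP.
rewrite big_ord_recl coefD coefMX coefC /= add0r addrC; congr (_ + _).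
by apply: eq_bigr => i _; rewrite coefD coefMX coefC /= addr0.
Qed.

Lemma l1M f g : l1_norm (f * g) <= l1_norm f * l1_norm g.
Proof.
elim/poly_ind: f => [|f c IH].
  by rewrite mul0r /l1_norm size_poly0 !big_ord0 mul0r.
rewrite l1_MXaddC !mulrDl; apply: le_trans (l1D _ _) _; apply: lerD.
  by rewrite mulrAC -[_ * 'X]addr0 -polyC0 l1_MXaddC normr0 addr0.
by rewrite mul_polyC l1Z.
Qed.

Lemma l1X f k : l1_norm (f ^+ k) <= l1_norm f ^+ k.
Proof.
elim: k => [|k IH]; first by rewrite !expr0 /l1_norm size_poly1 big_ord1 coef1
  normr1.
rewrite !exprS; apply: le_trans (l1M _ _) _.
by apply: ler_wpM2l; rewrite ?l1_ge0.
Qed.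

(** * Values in the closed unit disc and averages over roots of unity *)

Definition evalC (f : {poly rat}) (z : algC) : algC := (map_poly ratr f).[z].

Lemma evalCE (f : {poly rat}) z :
  evalC f z = \sum_(i < size f) ratr f`_i * z ^+ i.
Proof.
rewrite /evalC horner_coef size_map_poly.
by apply: eq_bigr => i _; rewrite coef_map.
Qed.

(** This serves for [p] evaluated at a truncation of order [N]: the coefficients below [N] vanish,
    so the value on a circle of radius less than 1 carries the small factor [r ^+ N]. *)
Lemma evalC_small (f : {poly rat}) (z : algC) (r : rat) N :
  `|z| = ratr r -> 0 <= r <= 1 -> (forall n, (n < N)%N -> f`_n = 0) ->
  `|evalC f z| <= ratr (r ^+ N * l1_norm f).
Proof.
move=> zr /andP[r0 r1] fN; rewrite evalCE;
  apply: le_trans (ler_norm_sum _ _ _) _.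
rewrite /l1_norm mulr_sumr rmorph_sum /=; apply: ler_sum => i _.
rewrite normrM normrX zr -ratr_norm -rmorphXn -rmorphM ler_rat mulrC.
case: (ltnP i N) => [iN|Ni]; first by rewrite fN // normr0 !mulr0.
by apply: ler_wpM2r => //; apply: ler_wiXn2l.
Qed.

Lemma evalC_bound (f : {poly rat}) (z : algC) :
  `|z| <= 1 -> `|evalC f z| <= ratr (l1_norm f).
Proof.
move=> z1; rewrite evalCE; apply: le_trans (ler_norm_sum _ _ _) _.
rewrite /l1_norm rmorph_sum /=; apply: ler_sum => i _.
rewrite normrM normrX -ratr_norm ler_piMr ?normr_ge0 ?ler0q //.
by apply: exprn_ile1.
Qed.

(** Expand the squared moduli and sum over [j] first: the sum of the powers of [x ^+ i / x ^+ k] is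
    [n] for [i = k] and 0 otherwise. *)
Lemma parseval (n : nat) (G : 'I_n -> algC) (x : algC) : n.-primitive_root x ->
  \sum_(j < n) `|\sum_(i < n) G i * x ^+ j ^+ i| ^+ 2 =
  n%:R * \sum_(i < n) `|G i| ^+ 2.
Proof.
move=> prim; have n0 : (0 < n)%N := prim_order_gt0 prim.
have xn : x ^+ n = 1 := prim_expr_order prim.
have x1 : `|x| = 1 by apply/eqP;
  rewrite -(@pexpr_eq1 _ _ n) // -normrX xn normr1.
have x0 : x != 0 by rewrite -normr_eq0 x1 oner_eq0.
have xc : x^* = x^-1 by rewrite invC_norm x1 expr1n invr1 mul1r.
transitivity (\sum_(j < n) \sum_(i < n) \sum_(k < n)
    (G i * (G k)^*) * (x ^+ i / x ^+ k) ^+ j).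
  apply: eq_bigr => j _; rewrite normCK rmorph_sum big_distrl /=.
  apply: eq_bigr => i _; rewrite big_distrr /=; apply: eq_bigr => k _.
  rewrite rmorphM !rmorphXn /= xc expr_div_n -!exprM !exprVn [(j * i)%N]mulnC
    [(j * k)%N]mulnC.
  by rewrite mulrACA.
rewrite exchange_big mulr_sumr; apply: eq_bigr => i _ /=.
rewrite exchange_big (bigD1 i) //= [X in _ + X]big1 ?addr0 => [|k ki].
  under eq_bigr => j _ do rewrite divff ?expf_neq0 // expr1n mulr1.
  by rewrite sumr_const card_ord normCK mulr_natl.
rewrite -mulr_sumr; apply/eqP; rewrite mulf_eq0; apply/orP; right.
have neq1 : x ^+ i / x ^+ k - 1 != 0.
  rewrite subr_eq0; apply: contra ki => /eqP e.
  have/eqP: x ^+ i = x ^+ k by rewrite -[RHS]mul1r -e divfK ?expf_neq0.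
  by rewrite (eq_prim_root_expr prim) !modn_small // eq_sym.
(* Multiplication by the nonzero [x ^+ i / x ^+ k - 1] telescopes the geometric sum to a difference
   of [n]-th powers, which are both 1. *)
rewrite -(mulrI_eq0 _ (lregM (mulfI neq1) (@lreg1 _))) mulr1 -subrX1.
by rewrite expr_div_n -!exprM ![(_ * n)%N]mulnC !exprM xn !expr1n divr1 subrr.
Qed.

(** * Subexponential sequences: coefficients of series with radius of convergence at least 1 *)

Definition subexp (u : nat -> rat) : Prop :=
  forall rho : rat, 1 < rho -> exists C : rat, forall n, `|u n| <= C * rho ^+ n.

Lemma bernoulli_ge (x : rat) n : -1 <= x -> 1 + n%:R * x <= (1 + x) ^+ n.
Proof.
move=> x0; elim: n => [|n IH]; first by rewrite expr0 mul0r addr0.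
have : 0 <= n%:R * (x * x) by rewrite mulr_ge0 // -expr2 sqr_ge0.
have : (1 + n%:R * x) * (1 + x) <= (1 + x) ^+ n * (1 + x).
  by apply: ler_wpM2r => //; lra.
by rewrite exprSr -natr1; lra.
Qed.

(** A rational substitute for a [k]-th root of [rho], by which a rate [rho] is shared among [k]
    factors. *)
Lemma exists_root_gt1 (rho : rat) k : 1 < rho ->
  exists2 sigma, 1 < sigma & sigma ^+ k <= rho.
Proof.
move=> rho1; have rho0 : 0 < rho by lra.
have V1 : rho^-1 < 1 by rewrite invf_lt1.
have V0 : 0 < rho^-1 by rewrite invr_gt0.
(* Bernoulli's inequality gives [(1 - y) ^+ k.+1 >= 1 - k.+1%:R * y = rho^-1]. Using [k.+1] keeps
   the division meaningful for [k = 0]. *)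
pose y := (1 - rho^-1) / k.+1%:R.
have ky : k.+1%:R * y = 1 - rho^-1 by rewrite mulrCA divff ?mulr1 // pnatr_eq0.
have y0 : 0 < y by rewrite divr_gt0 // subr_gt0.
have y1 : y <= 1 - rho^-1 by rewrite -ky ler_peMl ?ler1n // ltW.
have s1 : 1 < (1 - y)^-1 by rewrite invf_gt1; lra.
exists (1 - y)^-1 => //; apply: le_trans (_ : (1 - y)^-1 ^+ k.+1 <= _).
  by apply: ler_weXn2l => //; rewrite ltW.
rewrite exprVn invf_ple ?posrE ?exprn_gt0 //; last lra.
have := @bernoulli_ge (- y) k.+1; lra.
Qed.

Lemma expr_unbounded (rho C : rat) : 1 < rho ->
  exists N0, forall N, (N0 <= N)%N -> C <= rho ^+ N.
Proof.
move=> r1; have r0 : 0 < rho - 1 by lra.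
exists (Num.bound (C / (rho - 1))) => N le_N.
have := @bernoulli_ge (rho - 1) N; rewrite [1 + (rho - 1)]addrC subrK => h.
apply: le_trans (h _); last lra.
have : C / (rho - 1) <= N%:R.
  apply: le_trans (ler_norm _) _;
    apply: le_trans (ltW (archi_boundP (normr_ge0 _))) _.
  by rewrite /Num.bound normr_id ler_nat.
by rewrite ler_pdivrMr //; lra.
Qed.

Lemma subexp_le (u v : nat -> rat) : subexp v ->
  (forall n, `|u n| <= v n) -> subexp u.
Proof.
move=> sv uv rho r1; have [C hC] := sv rho r1; exists C => n.
by apply: le_trans (uv n) _; apply: le_trans (ler_norm _) _.
Qed.

Lemma subexp_cst c : subexp (fun=> c).
Proof.
move=> rho r1; exists `|c| => n.
by rewrite ler_peMr // exprn_ege1 // ltW.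
Qed.

Lemma subexp_nat : subexp (fun n => n.+1%:R).
Proof.
move=> rho r1; exists (1 + (rho - 1)^-1) => n.
have r0 : 0 < rho - 1 by lra.
rewrite ger0_norm //; have := @bernoulli_ge (rho - 1) n;
  rewrite [1 + (rho - 1)]addrC subrK => h.
have h1 : 1 + n%:R * (rho - 1) <= rho ^+ n by apply: h; lra.
have V0 : 0 < (rho - 1)^-1 by rewrite invr_gt0.
apply: le_trans (_ : _ <= (1 + (rho - 1)^-1) * (1 + n%:R * (rho - 1))) _;
  last first.
  by apply: ler_wpM2l => //; lra.
have -> : (1 + (rho - 1)^-1) * (1 + n%:R * (rho - 1)) =
   1 + n%:R + (rho - 1)^-1 + n%:R * (rho - 1) by field; lra.
rewrite -natr1; have : 0 <= n%:R * (rho - 1) by rewrite mulr_ge0 // ltW.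
lra.
Qed.

Lemma subexpD u v : subexp u -> subexp v -> subexp (fun n => u n + v n).
Proof.
move=> su sv rho r1; have [C hC] := su _ r1; have [D hD] := sv _ r1.
exists (C + D) => n; apply: le_trans (ler_normD _ _) _.
by rewrite mulrDl lerD.
Qed.

Lemma subexpM u v : subexp u -> subexp v -> subexp (fun n => u n * v n).
Proof.
move=> su sv rho r1; have [s s1 s2] := exists_root_gt1 2 r1.
have [C hC] := su _ s1; have [D hD] := sv _ s1.
have C0 : 0 <= C by have := hC 0%N; rewrite expr0 mulr1; apply: le_trans.
have D0 : 0 <= D by have := hD 0%N; rewrite expr0 mulr1; apply: le_trans.
have s0 : 0 < s by lra.
exists (C * D) => n; rewrite normrM.
apply: le_trans (ler_pM _ _ (hC n) (hD n)) _ => //.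
rewrite mulrACA -exprMn -expr2 ler_wpM2l ?mulr_ge0 //.
by apply: lerXn2r => //; rewrite nnegrE ?sqr_ge0 //; lra.
Qed.

Lemma subexp_ext u v : subexp u -> u =1 v -> subexp v.
Proof. by move=> su uv rho /su[C hC]; exists C => n; rewrite -uv. Qed.

Lemma subexpX u k : subexp u -> subexp (fun n => u n ^+ k).
Proof.
move=> su; elim: k => [|k IH]; first exact: subexp_cst.
by apply: subexp_ext (subexpM su IH) _ => n; rewrite exprS.
Qed.

Lemma subexp_sum k (u : nat -> nat -> rat) : (forall i, subexp (u i)) ->
  subexp (fun n => \sum_(i < k) u i n).
Proof.
move=> su; elim: k => [|k IH].
  by apply: subexp_ext (subexp_cst 0) _ => n; rewrite big_ord0.
by apply: subexp_ext (subexpD IH (su k)) _ => n; rewrite big_ord_recr.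
Qed.

Lemma subexp_psum u : subexp u -> subexp (fun n => \sum_(i < n) `|u i|).
Proof.
move=> su rho r1; have [s s1 s2] := exists_root_gt1 2 r1.
have [C hC] := su _ s1; have [D hD] := subexp_nat s1.
have C0 : 0 <= C by have := hC 0%N; rewrite expr0 mulr1; apply: le_trans.
have s0 : 0 < s by lra.
exists (C * D) => n; rewrite ger0_norm ?sumr_ge0 //.
apply: le_trans (_ : n%:R * (C * s ^+ n) <= _).
  rewrite mulr_natl -[X in _ *+ X]card_ord -sumr_const; apply: ler_sum => i _.
  apply: le_trans (hC i) _; apply: ler_wpM2l => //.
  by apply: ler_weXn2l; [rewrite ltW | rewrite ltnW].
apply: le_trans (_ : (D * s ^+ n) * (C * s ^+ n) <= _).
  apply: ler_wpM2r; first by rewrite mulr_ge0 // exprn_ge0 // ltW.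
  apply: le_trans (hD n); rewrite normr_nat ler_nat //.
rewrite mulrACA -exprMn -expr2 [D * C]mulrC ler_wpM2l ?mulr_ge0 //.
  by have := hD 0%N; rewrite expr0 mulr1; apply: le_trans.
by apply: lerXn2r => //; rewrite nnegrE ?sqr_ge0 //; lra.
Qed.

(** With [c] and [p] fixed, the norm is bounded by a fixed polynomial in the partial sums of
    [|a i|], and these are subexponential. *)
Lemma subexp_l1_subst (c : {poly rat}) (p : {poly {poly rat}}) a : subexp a ->
  subexp (fun N => l1_norm (c * p.[series_trunc a N])).
Proof.
move=> sa; pose A N := \sum_(i < N) `|a i|.
apply: (@subexp_le _ (fun N => l1_norm c * \sum_(k < size p) l1_norm p`_k * A N
  ^+ k)).
  apply: subexpM; first exact: subexp_cst.
  apply: (@subexp_sum _ (fun k N => l1_norm p`_k * A N ^+ k)) => k.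
  by apply: subexpM; [exact: subexp_cst | apply/subexpX/subexp_psum].
move=> N; rewrite ger0_norm ?l1_ge0 //; apply: le_trans (l1M _ _) _.
apply: ler_wpM2l; rewrite ?l1_ge0 // horner_coef.
apply: le_trans (l1_sum _) _; apply: ler_sum => k _.
apply: le_trans (l1M _ _) _; apply: ler_wpM2l; rewrite ?l1_ge0 //.
apply: le_trans (l1X _ _) _.
have l1A : l1_norm (series_trunc a N) = A N.
  rewrite (l1_wide (size_poly _ _)).
  by apply: eq_bigr => i _; rewrite coef_poly ltn_ord.
by rewrite l1A.
Qed.

(** * Integrality over polynomials and Fatou's argument *)

Lemma monic_relation (p : {poly {poly rat}}) (A : {poly rat}) d :
  size p = d.+2 -> let c := lead_coef p in
  c ^+ d * p.[A] =
  (c * A) ^+ d.+1 + \sum_(k < d.+1) (p`_k * c ^+ (d - k)) * (c * A) ^+ k.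
Proof.
move=> sp c; rewrite horner_coef sp big_ord_recr /= mulrDr addrC; congr (_ + _).
  have -> : p`_d.+1 = c by rewrite /c lead_coefE sp.
  by rewrite mulrA -exprSr exprMn.
rewrite mulr_sumr; apply: eq_bigr => k _.
have kd : (k <= d)%N by rewrite -ltnS.
rewrite exprMn -[in c ^+ d](subnK kd) exprD.
by rewrite mulrACA [c ^+ _ * p`__]mulrC.
Qed.

(** Cauchy's bound for roots: when [|y| > 1], isolate [y ^+ d.+1] and divide by [|y| ^+ d]; every
    other term is then at most its coefficient bound. *)
Lemma monic_root_bound d (y w : algC) (e B : 'I_d.+1 -> algC) :
  `|w| <= 1 -> (forall k, `|e k| <= B k) ->
  w = y ^+ d.+1 + \sum_k e k * y ^+ k -> `|y| <= 1 + \sum_k B k.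
Proof.
move=> w1 eB def_w.
have B0 k : 0 <= B k by apply: le_trans (eB k).
have sB0 : 0 <= \sum_k B k by apply: sumr_ge0.
have [y1|y1] := real_leP (normr_real y) (ger0_real (@ler01 algC)).
  by apply: le_trans y1 _; rewrite lerDl.
have y0 : 0 < `|y| by apply: lt_trans y1.
rewrite -(@ler_pM2r _ (`|y| ^+ d)) ?exprn_gt0 // -exprS -normrX.
have -> : y ^+ d.+1 = w - \sum_k e k * y ^+ k by rewrite def_w addrK.
apply: le_trans (ler_normB _ _) _; rewrite mulrDl mul1r; apply: lerD.
  by apply: le_trans w1 _; rewrite exprn_ege1 // ltW.
apply: le_trans (ler_norm_sum _ _ _) _; rewrite mulr_suml;
  apply: ler_sum => k _.
rewrite normrM normrX; apply: ler_pM => //; first by rewrite exprn_ge0.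
by apply: ler_weXn2l; [rewrite ltW | rewrite -ltnS].
Qed.

Lemma sum_sq_le_of_circle_bound (Y : {poly rat}) (r M : rat) n0 : 0 <= r <= 1 ->
  (forall z : algC, `|z| = ratr r -> `|evalC Y z| <= ratr M) ->
  r ^+ (2 * n0) * \sum_(i < n0) Y`_i ^+ 2 <= M ^+ 2.
Proof.
(* Taking [n] at least [size Y] keeps the exponents of [Y] distinct modulo [n], so the average over
   [n]-th roots of unity is exact. The bound [n0.+1] makes [n] positive and lets the sum up to [n0]
   fit inside. *)
move=> /andP[r0 r1] Y_le; pose n := maxn (size Y) n0.+1.
have n_gt0 : (0 < n)%N by rewrite leq_max orbT.
have le_n0 : (n0 <= n)%N by rewrite leq_max leqnSn orbT.
have [x prim] := C_prim_root_exists n_gt0.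
have x1 : `|x| = 1.
  apply/eqP; rewrite -(@pexpr_eq1 _ _ n) //.
  by rewrite -normrX (prim_expr_order prim) normr1.
have M0 : 0 <= M.
  rewrite -(ler0q algC); apply: le_trans (Y_le (ratr r) _) => //.
  by rewrite ger0_norm // ler0q.
pose G (i : 'I_n) : algC := ratr (Y`_i * r ^+ i).
have GE (j : 'I_n) : \sum_(i < n) G i * x ^+ j ^+ i = evalC Y (ratr r * x ^+ j).
  rewrite /evalC (@horner_coef_wide _ n);
    last by rewrite size_map_poly leq_maxl.
  apply: eq_bigr => i _; rewrite /G coef_map /= rmorphM rmorphXn /= -mulrA.
  by congr (_ * _); rewrite [RHS]exprMn.
have GM : \sum_(i < n) `|G i| ^+ 2 <= ratr (M ^+ 2).
  have n0R : 0 < n%:R :> algC by rewrite ltr0n.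
  rewrite -(ler_pM2l n0R) -(parseval G prim) mulr_natl -[X in _ *+ X]card_ord.
  rewrite -sumr_const; apply: ler_sum => j _; rewrite GE rmorphXn /=.
  apply: lerXn2r; rewrite ?nnegrE ?normr_ge0 ?ler0q //; apply: Y_le.
  by rewrite normrM normrX x1 expr1n mulr1 ger0_norm // ler0q.
have keyQ : \sum_(i < n) Y`_i ^+ 2 * r ^+ (2 * i) <= M ^+ 2.
  rewrite -(ler_rat algC); apply: le_trans GM; rewrite rmorph_sum /=.
  apply: ler_sum => i _; rewrite /G -ratr_norm -rmorphXn ler_rat /=.
  by rewrite -normrX exprMn -exprM [(i * 2)%N]mulnC ler_norm.
apply: le_trans keyQ; rewrite mulr_sumr.
rewrite (big_ord_widen n (fun i => r ^+ (2 * n0) * Y`_i ^+ 2)) //.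
rewrite big_mkcond /=; apply: ler_sum => i _; case: ifP => [i_lt|_].
  rewrite mulrC; apply: ler_wpM2l; first exact: sqr_ge0.
  by apply: ler_wiXn2l => //; rewrite leq_mul2l ltnW.
by rewrite mulr_ge0 ?sqr_ge0 ?exprn_ge0.
Qed.

(** For each [n0] take the circle of radius [rho^-1], with [rho] so close to 1 that passing to the
    unit circle costs a factor of at most 2. A long enough truncation nearly satisfies the monic
    relation there, and the root bound [M0] does not depend on [n0]. *)
Lemma algebraic_sum_sq_bound (p : {poly {poly rat}}) (a : nat -> rat) :
  p != 0 -> subexp a -> series_subst p a =1 (fun=> 0) ->
  exists M : rat, forall n0,
   \sum_(i < n0) series_mul (series_of_poly (lead_coef p)) a i ^+ 2 <= M.
Proof.
move=> p0 sa pa0; set c := lead_coef p.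
case sp: (size p) => [|[|d]].
- by move/eqP: sp; rewrite size_poly_eq0 (negPf p0).
(* In degree 0 in [z] the relation would say that a nonzero polynomial in [t] is zero. *)
- exfalso; have/size_poly1P[q q0 def_p] : size p == 1%N by rewrite sp.
  case/negP: q0; apply/eqP/polyP => n; rewrite coef0.
  by rewrite -[RHS](pa0 n) -(@coef_series_subst p a n.+1 n) // def_p hornerC.
pose B k := l1_norm (p`_k * c ^+ (d - k)).
pose M0 := 1 + \sum_(k < d.+1) B k.
have M0_ge0 : 0 <= M0 by rewrite addr_ge0 // sumr_ge0 // => k _; apply: l1_ge0.
exists (2 * M0 ^+ 2) => n0.
have [rho rho1 rho2] : exists2 rho : rat, 1 < rho & rho ^+ (2 * n0) <= 2.
  by apply: exists_root_gt1.
(* One factor [tau ^+ N] absorbs the growth of the norm and the other the constant [C]; together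
   they are at most [rho ^+ N], so the error on the circle is at most 1. *)
have [tau tau1 tau2] := exists_root_gt1 2 rho1.
have rho0 : 0 < rho by lra.
have tau0 : 0 < tau by lra.
have [C hC] := subexp_l1_subst (c ^+ d) p sa tau1.
have [N1 hN1] := expr_unbounded C tau1.
pose N := maxn N1 n0; pose Y := c * series_trunc a N.
have r01 : 0 <= rho^-1 <= 1 by rewrite invr_ge0 ltW //= invf_le1 // ltW.
have circ z : `|z| = ratr rho^-1 -> `|evalC Y z| <= ratr M0.
  move=> zr; have z1 : `|z| <= 1 by rewrite zr -(rmorph1 (@ratr algC)) ler_rat;
    lra.
  have := monic_relation (series_trunc a N) sp; rewrite /= -/c -/Y.
  move=> /(congr1 (fun f => evalC f z)).
  rewrite {2}/evalC rmorphD rmorph_sum rmorphXn /= hornerD horner_sum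
    horner_exp.
  under [X in _ = _ + X -> _]eq_bigr => k _.
    rewrite rmorphM rmorphXn /= hornerM horner_exp -/(evalC Y z).
    rewrite -/(evalC (p`_k * c ^+ (d - k)) z); over.
  rewrite -/(evalC Y z) => rel.
  rewrite /M0 rmorphD rmorph1 rmorph_sum /=.
  apply: (@monic_root_bound d _ _ _ (fun k => ratr (B k))) rel; last first.
    by move=> k; apply: evalC_bound.
  apply: le_trans (@evalC_small _ z rho^-1 N zr _ _) _ => //.
    move=> n nN; rewrite coefM big1 // => j _.
    by rewrite coef_series_subst ?pa0 ?mulr0 //;
      apply: leq_ltn_trans (leq_subr _ _) nN.
  rewrite -[X in _ <= X](rmorph1 (@ratr algC)) ler_rat exprVn mulrC ler_pdivrMr
    ?exprn_gt0 // mul1r.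
  apply: le_trans (ler_norm _) _; apply: le_trans (hC N) _.
  apply: le_trans (_ : tau ^+ N * tau ^+ N <= _).
    by apply: ler_wpM2r; [rewrite exprn_ge0 // ltW | apply: hN1;
      rewrite leq_maxl].
  rewrite -exprMn -expr2; apply: lerXn2r => //; rewrite nnegrE ?sqr_ge0 //; lra.
have := sum_sq_le_of_circle_bound n0 r01 circ.
rewrite exprVn mulrC ler_pdivrMr ?exprn_gt0 // => h.
have -> : \sum_(i < n0) series_mul (series_of_poly c) a i ^+ 2 = \sum_(i < n0)
  Y`_i ^+ 2.
  by apply: eq_bigr => i _; rewrite coef_mul_trunc // leq_max ltn_ord orbT.
by apply: le_trans h _; rewrite mulrC ler_wpM2r // sqr_ge0.
Qed.

(** Every nonzero [D * b i] has square at least 1, so at most [D ^+ 2 * M] terms are nonzero. *)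
Lemma sum_sq_bounded_eventually0 (b : nat -> rat) (D M : rat) : D != 0 ->
  (forall i, D * b i \is a Num.int) ->
  (forall n, \sum_(i < n) b i ^+ 2 <= M) ->
  exists N, forall n, (N <= n)%N -> b n = 0.
Proof.
move=> D0 Db_int bM.
pose cnt n := (\sum_(i < n) (b i != 0%R))%N.
have cnt_le n : (cnt n <= Num.bound (D ^+ 2 * M))%N.
  rewrite -(ler_nat rat) /cnt natr_sum.
  apply: le_trans (_ : \sum_(i < n) (D * b i) ^+ 2 <= _).
    apply: ler_sum => i _; case: eqP => [->|/eqP bi]; first by rewrite sqr_ge0.
    have : D * b i != 0 by rewrite mulf_neq0.
    by move=> nz /=; apply: sqr_intr_ge1.
  rewrite (eq_bigr (fun i : 'I_n => D ^+ 2 * b i ^+ 2)) => [|i _];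
    last by rewrite exprMn.
  rewrite -mulr_sumr; apply: le_trans (_ : D ^+ 2 * M <= _).
    by apply: ler_wpM2l (bM n); rewrite sqr_ge0.
  apply/ltW/archi_boundP; rewrite mulr_ge0 ?sqr_ge0 //.
  by have := bM 0%N; rewrite big_ord0.
(* At [N] the number of nonzero terms is already maximal; a nonzero term at some [n >= N] would
   increase it. *)
have [N Nmax] : exists N, forall n, (cnt n <= cnt N)%N.
  pose P k := `[< exists n, cnt n = k >].
  have exP : exists k, P k by exists (cnt 0%N); apply/asboolP; exists 0%N.
  have ubP k : P k -> (k <= Num.bound (D ^+ 2 * M))%N.
    by move=> /asboolP[n <-]; apply: cnt_le.
  case: (ex_maxnP exP ubP) => k /asboolP[N <-] max_k; exists N => n.
  by apply: max_k; apply/asboolP; exists n.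
exists N => n le_Nn; apply/eqP; apply: contraT => bn.
have := Nmax n.+1; rewrite leqNgt; case/negP.
rewrite /cnt big_ord_recr /= bn addn1 ltnS -/(cnt N) -/(cnt n).
by rewrite -(subnKC le_Nn) /cnt big_split_ord /= leq_addr.
Qed.

Lemma fatou (a : nat -> rat) : (forall n, a n \is a Num.int) -> subexp a ->
  algebraic_series a -> rational_series a.
Proof.
move=> a_int sa [p [p0 pa0]].
have [M hM] := algebraic_sum_sq_bound p0 sa pa0.
set c := lead_coef p in hM; have c0 : c != 0 by rewrite lead_coef_eq0.
have [q [D D0 def_c]] := rat_poly_scale c.
have D0' : D%:~R != 0 :> rat by rewrite intr_eq0.
have [N hN] : exists N, forall n, (N <= n)%N -> series_mul (series_of_poly c) a
  n = 0.
  apply: (sum_sq_bounded_eventually0 D0' _ hM) => i.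
  rewrite /series_mul mulr_sumr rpred_sum // => j _.
  rewrite /series_of_poly def_c coefZ mulrA mulrA divff // mul1r coef_map /=.
  by rewrite rpredM // ?a_int // intr_int.
(* The denominator must not vanish at 0, so the largest power ['X^v] is split off from [c].
   Coefficient [n] of [s a] is coefficient [n + v] of [c a]. *)
have [v [s s0 def_s]] := multiplicity_XsubC c 0.
rewrite c0 /= subr0 in s0 def_s.
exists (\poly_(i < N) series_mul (series_of_poly s) a i), s; split.
  by move: s0; rewrite -rootE.
move=> n; rewrite {2}/series_of_poly coef_poly; case: ltnP => // Nn.
have vn : (n < (n + v).+1)%N by rewrite ltnS leq_addr.
rewrite -(hN (n + v)%N) ?(leq_trans Nn) ?leq_addr //.
rewrite -(@coef_mul_trunc s a (n + v).+1) // -(@coef_mul_trunc c a (n + v).+1)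
  //.
by rewrite def_s mulrAC coefMXn ltnNge leq_addl addnK.
Qed.

(** * Multilinear identities *)

Lemma exists_max_mem (T : eqType) (F : T -> nat) (s : seq T) : s != [::] ->
  exists2 x, x \in s & forall y, y \in s -> (F y <= F x)%N.
Proof.
elim: s => // x s IH _; have [->|/IH[x0 x0s x0max]] := eqVneq s [::].
  by exists x => [|y]; rewrite inE // => /eqP->.
case: (leqP (F x) (F x0)) => [le_x|lt_x].
  by exists x0 => [|y]; rewrite inE ?x0s ?orbT // => /predU1P[->|/x0max].
exists x => [|y]; rewrite inE ?eqxx // => /predU1P[->//|/x0max le_y].
by apply: leq_trans le_y (ltnW lt_x).
Qed.

Section Algebra.
Variables (K : fieldType) (R : lmodType K) (mul : R -> R -> R).
Hypothesis alg : assoc_algebra mul.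

Let mulA : associative mul. Proof. by case: alg. Qed.

Lemma alg_mul_linl y : linear (mul^~ y).
Proof. by case: alg => -[h _] _; apply: h. Qed.

Lemma alg_mul_linr x : linear (mul x).
Proof. by case: alg => -[_ h] _; apply: h. Qed.

Lemma alg_mul0l y : mul 0 y = 0.
Proof.
have := alg_mul_linl y 1 0 0; rewrite !scale1r addr0 => /eqP.
by rewrite eq_sym -subr_eq0 addrK => /eqP.
Qed.

Lemma alg_mul0r x : mul x 0 = 0.
Proof.
have := alg_mul_linr x 1 0 0; rewrite !scale1r addr0 => /eqP.
by rewrite eq_sym -subr_eq0 addrK => /eqP.
Qed.

Lemma alg_mulZr a x y : mul x (a *: y) = a *: mul x y.
Proof. by have := alg_mul_linr x a y 0; rewrite alg_mul0r !addr0. Qed.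

Lemma alg_mul_suml I (r : seq I) (P : pred I) F y :
  mul (\sum_(i <- r | P i) F i) y = \sum_(i <- r | P i) mul (F i) y.
Proof.
apply: (big_morph (mul^~ y)); last exact: alg_mul0l.
by move=> u v; have := alg_mul_linl y 1 u v; rewrite !scale1r.
Qed.

Lemma alg_mul_sumr I (r : seq I) (P : pred I) F x :
  mul x (\sum_(i <- r | P i) F i) = \sum_(i <- r | P i) mul x (F i).
Proof.
apply: (big_morph (mul x)); last exact: alg_mul0r.
by move=> u v; have := alg_mul_linr x 1 u v; rewrite !scale1r.
Qed.

(** The value [e] of the empty product may fail to be a unit, which is why products are split only
    at nonempty lists. *)
Definition mprod (e : R) (s : seq R) : R :=
  if s is x :: s' then foldl mul x s' else e.

Lemma word_evalE e r w : word_eval mul e r w = mprod e (map r w).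
Proof.
case: w => //= i w; elim: w (r i) => //= j w IH x; exact: IH.
Qed.

Lemma mprod_rcons e s x : s != [::] -> mprod e (rcons s x) = mul (mprod e s) x.
Proof. by case: s => // y s _; rewrite /= foldl_rcons. Qed.

Lemma mprod_cat e s t : s != [::] -> t != [::] ->
  mprod e (s ++ t) = mul (mprod e s) (mprod e t).
Proof.
move=> s0; elim/last_ind: t => // t x IH _; rewrite -rcons_cat.
have [->|t0] := eqVneq t [::]; first by rewrite cats0 mprod_rcons.
by rewrite !mprod_rcons // ?IH ?mulA //; case: (s) s0.
Qed.

Lemma mprod_flatten e (ss : seq (seq R)) : all (fun s => s != [::]) ss ->
  mprod e (flatten ss) = mprod e (map (mprod e) ss).
Proof.
elim/last_ind: ss => //= ss s IH; rewrite all_rcons => /andP[s0 hss].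
rewrite flatten_rcons map_rcons.
have [->|ss0] := eqVneq ss [::]; first by [].
rewrite mprod_cat // ?IH // ?mprod_rcons //; first by case: (ss) ss0.
by case: (ss) ss0 hss => //= -[].
Qed.

Fixpoint all_words d L : seq (seq 'I_d) :=
  if L is L'.+1 then [seq rcons t i | t <- all_words d L', i <- enum 'I_d]
  else [:: [::]].

Lemma mem_all_words d L t : (t \in all_words d L) = (size t == L).
Proof.
elim: L t => [|L IH] t; first by rewrite inE; case: t.
apply/allpairsP/eqP => [[[t' i] [/= + _ ->]]|].
  by rewrite IH => /eqP <-; rewrite size_rcons.
case/lastP: t => // t i; rewrite size_rcons => -[st].
by exists (t, i); split; rewrite ?mem_enum ?IH ?st.
Qed.

Lemma all_words_uniq d L : uniq (all_words d L).
Proof.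
elim: L => //= L IH; apply: allpairs_uniq; rewrite ?enum_uniq //.
by move=> [t i] [t' i'] _ _ /= /rcons_inj[-> ->].
Qed.

(* Substituting [x_k := \sum_(i in S | x0 i = k) y_i] in [f] and summing over
   all [S] with signs keeps exactly the monomials that contain every [y_i]; if
   the degree of [f] is at most [d], these are multilinear. *)
Section Linearization.
Variables (d : nat) (x0 : 'I_d -> nat) (y : 'I_d -> R) (e : R).

Definition split_var (S : {set 'I_d}) (k : nat) : R :=
  \sum_(i in S | x0 i == k) y i.

(** Multiplying out the sums amounts to choosing an index for each letter of [w], and such a choice
    is a word [t] over ['I_d]. *)
Lemma word_eval_split S w : mprod e (map (split_var S) w) =
  \sum_(t <- all_words d (size w) | all (mem S) t && (map x0 t == w))
    mprod e (map y t).
Proof.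
elim/last_ind: w => [|w k IH]; first by rewrite /= big_mkcond big_seq1 /=.
rewrite map_rcons size_rcons [RHS]big_mkcond /= big_allpairs_dep /=.
have split_sum : split_var S k = \sum_(i <- enum 'I_d | (i \in S) && (x0 i ==
  k)) y i.
  by rewrite /split_var big_enum_cond.
have [w0|w0] := eqVneq w [::].
  rewrite w0 /= big_seq1 split_sum -[RHS]big_mkcond;
    apply: eq_big => [i|i _] //.
  by rewrite /= andbT eqseq_cons eqxx andbT.
rewrite mprod_rcons ?IH; last by case: (w) w0.
rewrite split_sum alg_mul_suml [LHS]big_mkcond /= big_seq [RHS]big_seq.
apply: eq_bigr => t; rewrite mem_all_words => /eqP st.
have t0 : t != [::] by rewrite -size_eq0 st size_eq0.
case: ifP => [/andP[tS /eqP tw]|tN].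
  rewrite alg_mul_sumr -[RHS]big_mkcond; apply: eq_big => [i|i _].
    by rewrite all_rcons map_rcons eqseq_rcons tS tw eqxx !andbT.
  by rewrite map_rcons mprod_rcons //; case: (t) t0.
rewrite big1 // => i _; rewrite all_rcons map_rcons eqseq_rcons;
  case: ifP => //.
by move=> /andP[/andP[_ tS] /andP[tw _]]; rewrite tS tw in tN.
Qed.

Definition set_sign (S : {set 'I_d}) : K := \prod_i (if i \in S then 1 else -1).

(** Inclusion-exclusion, written as a product over the indices: one that is missing from [t] may lie
    in [S] or not and contributes [1 - 1 = 0]. *)
Lemma sum_set_sign (t : seq 'I_d) :
  \sum_(S : {set 'I_d} | all (mem S) t) set_sign S =
  (all (mem t) (enum 'I_d))%:R.
Proof.
transitivity (\prod_(i : 'I_d) (1 + - (i \notin t)%:R : K)); last first.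
  have [/allP h|/allPn[i _ it]] := boolP (all _ _).
    rewrite big1 // => i _; have it : i \in t by apply: h; rewrite mem_enum.
    by rewrite it oppr0 addr0.
  by rewrite (bigD1 i) //= -[_ \notin _]/(~~ mem t i) it subrr mul0r.
rewrite (@bigA_distr _ _ _ _ _ _ (fun=> 1) (fun i => - (i \notin t)%:R))
  big_mkcond /=.
apply: eq_bigr => S _; case: ifP => [/allP tS|/negbT/allPn[i it iS]].
  apply: eq_bigr => i _; case: ifP => // iS.
  by case: (boolP (i \in t)) => [/tS|]; rewrite /= ?iS.
by rewrite (bigD1 i) //= (negPf iS : (i \in S) = false) it oppr0 mul0r.
Qed.

Lemma linearized_eval (f : {malg K[{fmonom nat}]}) :
  (forall w : {fmonom nat}, w \in msupp f -> (size w <= d)%N) ->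
  (forall r, free_eval mul e r f = 0) ->
  \sum_(t <- permutations (enum 'I_d))
     (\sum_(w <- msupp f | map x0 t == w) f@_w) *: mprod e (map y t) = 0.
Proof.
move=> f_deg f_id.
have : \sum_(S : {set 'I_d}) set_sign S *: free_eval mul e (split_var S) f = 0.
  by apply: big1 => S _; rewrite f_id scaler0.
rewrite /free_eval; move=> h; rewrite -[RHS]h.
under [RHS]eq_bigr => S _ do rewrite scaler_sumr.
rewrite exchange_big /=.
under eq_bigr => t _ do rewrite scaler_suml big_mkcond /=.
rewrite exchange_big /= big_seq [RHS]big_seq; apply: eq_bigr => w w_f.
rewrite -big_mkcond /=.
under [RHS]eq_bigr => S _.
  rewrite word_evalE word_eval_split scalerA mulrC -scalerA scaler_sumr
    big_mkcondl.
  over.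
rewrite -scaler_sumr -scaler_sumr exchange_big /=; congr (_ *: _).
transitivity (\sum_(t <- all_words d (size w) | (map x0 t == w) && all (mem t)
  (enum 'I_d))
   mprod e (map y t)); last first.
  rewrite big_mkcondr; apply: eq_bigr => t _.
  rewrite -big_mkcond -scaler_suml sum_set_sign.
  by case: ifP; rewrite ?scale1r ?scale0r.
rewrite -big_filter -[RHS]big_filter; apply: perm_big; apply: uniq_perm.
- by rewrite filter_uniq // permutations_uniq.
- by rewrite filter_uniq // all_words_uniq.
move=> t; rewrite !mem_filter mem_permutations mem_all_words -andbA.
case: eqP => //= tw; apply/idP/andP => [t_enum|[/allP t_full /eqP st]].
  split; last by rewrite -tw size_map.
  by apply/allP => i; rewrite /= (perm_mem t_enum).
(* A word of length at most [d] that contains all [d] indices contains each exactly once. *)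
have st' : (size t <= size (enum 'I_d))%N by rewrite size_enum_ord st f_deg.
rewrite perm_sym; apply: uniq_perm.
- exact: enum_uniq.
- by apply: leq_size_uniq t_full st'; apply: enum_uniq.
- by have [] := uniq_min_size (enum_uniq _) t_full st'.
Qed.

End Linearization.

Definition multilinear_identity d (alpha : seq 'I_d -> K) : Prop :=
  forall e y,
    \sum_(t <- permutations (enum 'I_d)) alpha t *: mprod e (map y t) = 0.

Lemma PI_multilinear : PI_algebra mul -> (forall x : R, x = 0) \/
  exists d (alpha : seq 'I_d.+1 -> K),
    alpha (enum 'I_d.+1) != 0 /\ multilinear_identity alpha.
Proof.
move=> [f [f0 [f_unital f_nonunital]]].
have [e [f_id e_case]] : exists e, (forall r, free_eval mul e r f = 0) /\
   (is_unity mul e \/ f@_mone = 0).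
  have [[e e1]|no1] := pselect (exists e, is_unity mul e).
    by exists e; split; [apply: f_unital | left].
  by have [f1 f_id] := f_nonunital no1; exists 0; split; [|right].
have [w0 w0_f w0_max] : exists2 w0 : {fmonom nat}, w0 \in msupp f &
    forall w : {fmonom nat}, w \in msupp f -> (size w <= size w0)%N.
  apply: (exists_max_mem (fun w : {fmonom nat} => size w) (s := msupp f)).
  apply: contra f0 => /eqP s0; apply/eqP/malgP => w; rewrite mcoeff0; apply/eqP.
  by rewrite mcoeff_eq0 -[_ \in _]/(w \in (msupp f : seq _)) s0.
(* Index [i] is sent to the [i]-th letter of a longest monomial [w0], so the identity arrangement
   has the nonzero coefficient of [w0]. *)
pose d := size w0; pose x0 (i : 'I_d) := nth 0%N w0 i.
pose alpha (t : seq 'I_d) := \sum_(w <- msupp f | map x0 t == w) f@_w.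
have alpha0 : alpha (enum 'I_d) != 0.
  rewrite /alpha; have -> : map x0 (enum 'I_d) = w0.
    by rewrite (map_comp (nth 0%N w0) val) val_enum_ord map_nth_iota0 //
      take_size.
  rewrite (big_rem w0) //= eqxx big1_seq ?addr0 ?mcoeff_neq0 // => w /andP[/eqP
    eq_w].
  have -> : w = w0 by apply: val_inj.
  by rewrite mem_rem_uniqF // fset_uniq.
have lin y := linearized_eval x0 y w0_max f_id.
have: size w0 = d by [].
move: (d) x0 @alpha alpha0 lin => [|d'] x0 alpha alpha0 lin sw0.
  (* In degree 0 the identity is a nonzero constant. This contradicts the missing constant term, or
     else forces the unit to be 0 and the algebra to vanish. *)
  left; have w00 : w0 = mone by apply: val_inj; rewrite /= fm1; apply: size0nil.
  case: e_case => [[e1 _] x|f1]; last by move: w0_f;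
    rewrite w00 -mcoeff_neq0 f1 eqxx.
  have := lin (fun=> 0); rewrite enum_ord0 /= big_seq1 /= => /eqP.
  rewrite scaler_eq0 => /orP[a0|/eqP e0].
    by move: alpha0; rewrite /alpha enum_ord0 a0.
  by rewrite -(e1 x) e0 alg_mul0l.
right; exists d', alpha; split => // e' y;
  rewrite -[RHS](lin y) big_seq [RHS]big_seq.
apply: eq_bigr => t; rewrite mem_permutations => /perm_size;
  rewrite size_enum_ord.
by case: t.
Qed.
End Algebra.

(** * Reduction to normal words *)

(** The coordinates of a basis with respect to [v] form a matrix with independent rows, so it has at
    most [N] rows. The default value 0 of [dim] satisfies the bound trivially. *)
Lemma dim_le_spanning (K : fieldType) (R : lmodType K) (V : {pred R}) N
    (v : 'I_N -> R) :
  (forall x, x \in V -> exists c : 'I_N -> K, x = \sum_i c i *: v i) ->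
  (Defs.dim V <= N)%N.
Proof.
move=> v_span; rewrite /Defs.dim; case: xgetP => // _ -> [b [bV b_free _]].
move: (xget _ _) b bV b_free => d b bV b_free.
have /choice[M hM] i : exists c : 'I_N -> K, b i = \sum_j c j *: v j.
  exact/v_span/bV.
pose A := \matrix_(i < d, j < N) M i j.
have ker0 : kermx A = 0.
  apply/row_matrixP => k; rewrite row0; apply/rowP => i; rewrite [RHS]mxE.
  apply: (b_free (fun i => row k (kermx A) 0 i)).
  have rA0 : row k (kermx A) *m A = 0 by apply/sub_kermxP; apply: row_sub.
  under eq_bigr => j _ do rewrite hM scaler_sumr.
  rewrite exchange_big /= big1 // => j _.
  under eq_bigr => i' _ do rewrite scalerA.
  rewrite -scaler_suml; suff -> : \sum_i' row k (kermx A) 0 i' * M i' j = 0.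
    by rewrite scale0r.
  transitivity ((row k (kermx A) *m A) 0 j); last by rewrite rA0 mxE.
  by rewrite [RHS]mxE; apply: eq_bigr => i' _; rewrite [A _ _]mxE.
have /eqP <- : row_free A by rewrite -kermx_eq0 ker0.
exact: rank_leq_col.
Qed.

Section Reduction.
Variables (K : fieldType) (R : lmodType K) (mul : R -> R -> R).
Hypothesis alg : assoc_algebra mul.
Variables (l : nat) (g : 'I_l -> R) (e : R).

Definition gen_eval (w : seq 'I_l) : R := mprod mul e (map g w).

(* Membership in the span of the values of the words satisfying [Q], as
   membership in every subspace containing them. *)
Definition word_span (Q : seq 'I_l -> Prop) (x : R) : Prop :=
  forall S : R -> Prop, S 0 -> (forall a u v, S u -> S v -> S (a *: u + v)) ->
  (forall w, Q w -> S (gen_eval w)) -> S x.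

Lemma word_span0 Q : word_span Q 0.
Proof. by []. Qed.

Lemma word_span_lin Q a u v :
  word_span Q u -> word_span Q v -> word_span Q (a *: u + v).
Proof. by move=> hu hv S S0 Slin SQ; apply: (Slin);
  [apply: hu | apply: hv]. Qed.

Lemma word_span_ev (Q : seq 'I_l -> Prop) w : Q w -> word_span Q (gen_eval w).
Proof. by move=> Qw S _ _; apply. Qed.

Lemma word_span_sub (Q Q' : seq 'I_l -> Prop) x :
  (forall w, Q w -> word_span Q' (gen_eval w)) ->
  word_span Q x -> word_span Q' x.
Proof.
by move=> QQ' hx; apply: hx => // a u v; apply: word_span_lin.
Qed.

Lemma word_span_sum Q (I : eqType) (r : seq I) (P : pred I) (c : I -> K) F :
  (forall i, i \in r -> P i -> word_span Q (F i)) ->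
  word_span Q (\sum_(i <- r | P i) c i *: F i).
Proof.
move=> QF; rewrite big_seq_cond; apply: big_ind.
- exact: word_span0.
- by move=> u v hu hv; rewrite -[u]scale1r; apply: word_span_lin.
- move=> i /andP[ir Pi]; rewrite -[_ *: _]addr0.
  by apply: word_span_lin (QF i ir Pi) (@word_span0 _).
Qed.

Lemma gen_eval_cat w w' : w != [::] -> w' != [::] ->
  gen_eval (w ++ w') = mul (gen_eval w) (gen_eval w').
Proof.
by move=> w0 w0'; rewrite /gen_eval map_cat mprod_cat // -size_eq0 size_map
  size_eq0.
Qed.

Lemma gen_eval_flatten us : all (fun u => u != [::]) us ->
  gen_eval (flatten us) = mprod mul e (map gen_eval us).
Proof.
move=> us0; rewrite /gen_eval map_flatten mprod_flatten //;
  first by rewrite -map_comp.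
by rewrite all_map; apply: sub_all us0 => u /=; rewrite -!size_eq0 size_map.
Qed.

Variables (d : nat) (alpha : seq 'I_d.+1 -> K).
Hypotheses (alpha0 : alpha (enum 'I_d.+1) != 0)
  (lin : multilinear_identity mul alpha).
Variables (m : nat).
Hypothesis m_gt0 : (0 < m)%N.

Let permuted (us : seq (seq 'I_l)) (t : seq 'I_d.+1) :=
  [seq nth [::] us i | i : 'I_d.+1 <- t].

Lemma permuted_id us : size us = d.+1 -> permuted us (enum 'I_d.+1) = us.
Proof.
move=> sus; rewrite /permuted (map_comp (nth [::] us) val) val_enum_ord.
by rewrite -sus map_nth_iota0 // take_size.
Qed.

Lemma gen_eval_permuted_relation p us :
  size us = d.+1 -> all (fun u => u != [::]) us ->
  \sum_(t <- permutations (enum 'I_d.+1))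
    alpha t *: gen_eval (p ++ flatten (permuted us t)) = 0.
Proof.
move=> sus us0.
have nz t : t \in permutations (enum 'I_d.+1) -> flatten (permuted us t) !=
  [::].
  rewrite mem_permutations => /perm_size; rewrite size_enum_ord.
  case: t => // i t _ /=; have : nth [::] us i \in us by rewrite mem_nth // sus.
  by move=> /(allP us0); case: (nth _ _ _).
have us0' t : all (fun u => u != [::]) (permuted us t).
  by apply/allP => _ /mapP[i _ ->]; apply: (allP us0); rewrite mem_nth // sus.
have lin0 : \sum_(t <- permutations (enum 'I_d.+1)) alpha t *: gen_eval
  (flatten (permuted us t)) = 0.
  rewrite -[RHS](lin e (fun i => gen_eval (nth [::] us i)));
    apply: eq_bigr => t _.
  by rewrite gen_eval_flatten // /permuted -map_comp.
have [->|p0] := eqVneq p [::]; first exact: lin0.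
transitivity (mul (gen_eval p) 0); last exact: alg_mul0r.
rewrite -[in RHS]lin0 alg_mul_sumr // big_seq [RHS]big_seq;
  apply: eq_bigr => t /nz t0.
by rewrite gen_eval_cat // alg_mulZr.
Qed.

(** Induction on [word_num w]: the identity, solved for its term at the identity permutation,
    replaces a word that is not normal by words with permuted factors and smaller value. *)
Lemma gen_eval_reduce w :
  word_span (fun w' => normal_word m d w' /\ perm_eq w' w) (gen_eval w).
Proof.
have [n] := ubnP (word_num w); elim: n w => // n IH w; rewrite ltnS => le_n.
have [nw|/not_normalP[p [us [def_w sus mus srt]]]] := boolP (normal_word m d w).
  exact: word_span_ev.
have us0 : all (fun u => u != [::]) us.
  by apply: sub_all mus => u mu; rewrite -size_eq0 -lt0n (leq_trans m_gt0).
(* Strictly decreasing keys make the factors distinct, so a nontrivial permutation really changes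
   the list. *)
have us_uniq : uniq us.
  by apply: map_uniq; apply: sorted_uniq srt;
    [apply: rev_trans ltn_trans | apply: ltnn].
have := gen_eval_permuted_relation p sus us0.
rewrite (big_rem (enum 'I_d.+1)) /=; last by rewrite mem_permutations.
rewrite permuted_id // -def_w => /eqP; rewrite addr_eq0 => /eqP rel.
have -> : gen_eval w = (alpha (enum 'I_d.+1))^-1 *: (alpha (enum 'I_d.+1) *:
  gen_eval w).
  by rewrite scalerA mulVf ?scale1r.
rewrite rel -[X in word_span _ X]addr0 scalerN -scaleNr.
apply: word_span_lin; last exact: word_span0.
apply: word_span_sum => t; rewrite rem_filter ?permutations_uniq // mem_filter
  /=.
rewrite mem_permutations => /andP[t_neq t_perm] _.
have perm_us : perm_eq (permuted us t) us.
  by rewrite -[X in perm_eq _ X](permuted_id sus); apply: perm_map.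
have neq_us : permuted us t != us.
  apply: contra t_neq => /eqP; rewrite -{2}(permuted_id sus) => eq_us.
  apply/eqP; apply: (inj_map _ eq_us) => i j /eqP.
  by rewrite nth_uniq ?sus // => /eqP/ord_inj.
have perm_w : perm_eq (p ++ flatten (permuted us t)) w.
  by rewrite def_w perm_cat2l; apply: perm_flatten.
apply: word_span_sub (IH _ _) => [w' [nw' pw']|].
  by apply: word_span_ev; split=> //; apply: perm_trans perm_w.
apply: leq_trans le_n; rewrite def_w !word_num_cat.
rewrite (size_flatten_perm perm_us) ltn_add2l.
exact: word_num_flatten_lt mus srt perm_us neq_us.
Qed.

Variables (Rn : nat -> {pred R}) (dg : 'I_l -> nat).
Hypotheses (gr : grading mul Rn) (e_deg : e \in Rn 0%N)
  (e_case : is_unity mul e \/ e = 0)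
  (g_deg : forall i, g i \in Rn (dg i)) (dg_gt0 : forall i, (0 < dg i)%N).

Definition word_deg (w : seq 'I_l) : nat := sumn (map dg w).

Lemma size_le_word_deg w : (size w <= word_deg w)%N.
Proof. by elim: w => //= i w IH; rewrite /word_deg /= -add1n leq_add. Qed.

Lemma gen_eval_mul Q w w' : word_span Q (gen_eval (w ++ w')) ->
  word_span Q (mul (gen_eval w) (gen_eval w')).
Proof.
have ev0 : gen_eval [::] = e by [].
have [->|w0] := eqVneq w [::].
  rewrite ev0; case: e_case => [[e1 _]|->]; first by rewrite e1.
  by rewrite alg_mul0l // => _; apply: word_span0.
have [->|w0'] := eqVneq w' [::].
  rewrite cats0 ev0; case: e_case => [[_ e1]|->]; first by rewrite e1.
  by rewrite alg_mul0r // => _; apply: word_span0.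
by rewrite gen_eval_cat.
Qed.

Lemma gen_eval_homog w : gen_eval w \in Rn (word_deg w).
Proof.
elim/last_ind: w => // w i IH; rewrite /word_deg map_rcons sumn_rcons.
have [->|w0] := eqVneq w [::]; first exact: g_deg.
by rewrite -cats1 gen_eval_cat //; apply: (grading_mul gr) => //; apply: g_deg.
Qed.

Lemma word_span_homog Q n x :
  (forall w, Q w -> word_deg w = n) -> word_span Q x -> x \in Rn n.
Proof.
have [R0 Rlin] := grading_subspace gr n.
by move=> Qn hx; apply: (hx (fun x => x \in Rn n)) => // w /Qn <-;
  apply: gen_eval_homog.
Qed.

Hypothesis gen : forall S : {pred R}, GRing.submod_closed S ->
  {in S &, forall x y, mul x y \in S} -> e \in S -> (forall i, g i \in S) ->
  forall x, x \in S.

(** The span of normal words is a subalgebra: the product of two word values is the value of the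
    concatenation, or 0 in a degenerate case, and is reduced again. *)
Lemma normal_words_span x : word_span (normal_word m d) x.
Proof.
pose S : {pred R} := [pred x | `[< word_span (normal_word m d) x >]].
have SE y : (y \in S) <-> word_span (normal_word m d) y by split => /asboolP.
have red w : word_span (normal_word m d) (gen_eval w).
  by apply: word_span_sub (@gen_eval_reduce w) => w' [nw' _];
    apply: word_span_ev.
apply/SE; apply: gen => [||| i].
- split; first by apply/SE; apply: word_span0.
  by move=> a u v /SE hu /SE hv; apply/SE; apply: word_span_lin.
- move=> u v /SE hu /SE hv; apply/SE;
  apply: (hu (fun u => word_span _ (mul u v))).
  + by rewrite alg_mul0l //; apply: word_span0.
  + by move=> a u1 u2 h1 h2; rewrite (alg_mul_linl alg); apply: word_span_lin.
  move=> w _; apply: (hv (fun v => word_span _ (mul (gen_eval w) v))).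
  + by rewrite alg_mul0r //; apply: word_span0.
  + by move=> a u1 u2 h1 h2; rewrite (alg_mul_linr alg); apply: word_span_lin.
  by move=> w' _; apply: gen_eval_mul; apply: red.
- by apply/SE; apply: (red [::]).
- by apply/SE; apply: (red [:: i]).
Qed.

(** Sort a combination of normal words by degree; directness of the grading identifies the part of
    degree [n] with [x] itself. *)
Lemma homog_normal_span n x : x \in Rn n ->
  word_span (fun w => normal_word m d w /\ word_deg w = n) x.
Proof.
move=> xn; pose V i := word_span (fun w => normal_word m d w /\ word_deg w = i).
(* The equality is required for all large [M], so that decompositions with different bounds can be
   added. *)
pose decomp y := exists c : nat -> R, (forall i, V i (c i)) /\
    exists N, forall M, (N <= M)%N -> y = \sum_(i < M) c i.
have [c [cV [N hN]]] : decomp x.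
  apply: (@normal_words_span x decomp) => [|a u v [c [cV [N hN]]] [c' [cV' [N'
    hN']]]|w nw].
  - exists (fun=> 0); split; first by move=> i; apply: word_span0.
    by exists 0%N => M _; rewrite big1.
  - exists (fun i => a *: c i + c' i); split; first by move=> i;
    apply: word_span_lin; [apply: cV | apply: cV'].
    exists (maxn N N') => M; rewrite geq_max => /andP[/hN-> /hN'->].
    by rewrite scaler_sumr -big_split.
  exists (fun i => if i == word_deg w then gen_eval w else 0); split.
    by move=> i; case: eqP => [->|_]; [apply: word_span_ev | apply: word_span0].
  exists (word_deg w).+1 => M lt_M; rewrite (bigD1 (Ordinal lt_M)) //= eqxx.
  by rewrite big1 ?addr0 // => i; rewrite -val_eqE /= => /negPf->.
suff <- : c n = x by apply: cV.
have Rsub i : GRing.submod_closed (Rn i) := grading_subspace gr i.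
pose c' i := c i - (if i == n then x else 0).
have c'R i : c' i \in Rn i.
  rewrite /c' addrC -scaleN1r; apply: (Rsub i).2.
    by case: eqP => [->|_] //; apply: (Rsub i).1.
  by apply: word_span_homog (cV i) => w [].
have lt_n : (n < maxn N n.+1)%N by rewrite leq_max leqnn orbT.
have := grading_direct gr c'R (n := maxn N n.+1) _ lt_n; rewrite /c' eqxx => h.
apply/eqP; rewrite -subr_eq0; apply/eqP/h.
rewrite sumrB -hN ?leq_maxl // (bigD1 (Ordinal lt_n)) //= eqxx.
by rewrite big1 ?addr0 ?subrr // => i; rewrite -val_eqE /= => /negPf->.
Qed.

(** Generators have positive degree, so words of degree [n] have length at most [n] and there are
    finitely many of them. *)
Lemma dim_le_normal_words n : exists W : seq (seq 'I_l),
  [/\ uniq W, forall w, w \in W -> (size w <= n)%N /\ normal_word m d w &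
      (Defs.dim (Rn n) <= size W)%N].
Proof.
pose W := [seq w <- map val (enum {: {bseq n of 'I_l}}) | normal_word m d w &&
  (word_deg w == n)].
have memW w : (w \in W) = normal_word m d w && (word_deg w == n).
  rewrite mem_filter; case: (boolP (normal_word m d w && _)) => //= /andP[_
    /eqP wn].
  have sw : (size w <= n)%N by rewrite -wn size_le_word_deg.
  by apply/mapP; exists (Bseq sw); rewrite ?mem_enum.
exists W; split.
- by rewrite filter_uniq // map_inj_uniq ?enum_uniq //; apply: val_inj.
- by move=> w; rewrite memW => /andP[nw /eqP <-]; split;
  first apply: size_le_word_deg.
apply: (@dim_le_spanning _ _ _ _ (fun i => gen_eval (nth [::] W i))) => x
  /homog_normal_span hx.
apply: (hx (fun x => exists c, x = \sum_(i < size W) c i *: gen_eval (nth [::]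
  W i))) => [|a u v [c ->] [c' ->]|w [nw wn]].
- by exists (fun=> 0); rewrite big1 // => i _; rewrite scale0r.
- exists (fun i => a * c i + c' i); rewrite scaler_sumr -big_split /=.
  by apply: eq_bigr => i _; rewrite scalerDl scalerA.
have wW : w \in W by rewrite memW nw wn eqxx.
have iW : (index w W < size W)%N by rewrite index_mem.
exists (fun i => (i == Ordinal iW)%:R);
  rewrite (bigD1 (Ordinal iW)) //= eqxx scale1r.
by rewrite nth_index // big1 ?addr0 // => i /negPf->; rewrite scale0r.
Qed.

End Reduction.

(** * Homogeneous generators of positive degree *)

Lemma homog_generators (K : fieldType) (R : lmodType K) (mul : R -> R -> R)
    (Rn : nat -> {pred R}) (e : R) (s : seq R) :
  grading mul Rn -> (forall x, x \in Rn 0%N -> exists a : K, x = a *: e) ->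
  exists G : seq (nat * R),
    (forall q, q \in G -> (0 < q.1)%N /\ q.2 \in Rn q.1) /\
    forall S : {pred R}, GRing.submod_closed S -> e \in S ->
      (forall q, q \in G -> q.2 \in S) -> {subset s <= S}.
Proof.
move=> gr R0; elim: s => [|x s [G [Gdeg Ggen]]]; first by exists [::].
have [n [c [cR ->]]] := grading_span gr x.
(* Each generator is replaced by its homogeneous components of positive degree; its component of
   degree 0 is a multiple of [e]. *)
exists ([seq (i, c i) | i <- iota 1 n] ++ G); split=> [q|S Ssub eS GS].
  rewrite mem_cat => /orP[/mapP[i + ->]|/Gdeg//].
  by rewrite mem_iota => /andP[i0 _]; split; last apply: cR.
have [S0 Slin] := Ssub.
move=> y; rewrite inE => /predU1P[->|]; last first.
  by move: y; apply: Ggen => // q qG; apply: GS; rewrite mem_cat qG orbT.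
apply: (big_ind (fun y => y \in S)) => // [u v uS vS|i _];
  first by rewrite -[u]scale1r Slin.
case: (posnP i) => [i0|i_gt0].
  have /R0[a ->] : c i \in Rn 0%N by rewrite i0; apply: cR.
  by rewrite -[_ *: _]addr0 Slin.
apply: (GS (i : nat, c i)); rewrite mem_cat; apply/orP; left.
by apply/mapP; exists (i : nat) => //; rewrite mem_iota i_gt0 add1n ltnS ltnW.
Qed.

(** * Subexponential growth of the Hilbert series *)

Section HilbertGrowth.
Variables (K : fieldType) (R : lmodType K) (mul : R -> R -> R).
Variable Rn : nat -> {pred R}.
Hypotheses (alg : assoc_algebra mul) (gr : grading mul Rn)
  (conn : connected mul Rn) (fg : finitely_generated mul).

Lemma dim_le_normal_words_fg : exists l : nat,
  forall d (alpha : seq 'I_d.+1 -> K), alpha (enum 'I_d.+1) != 0 ->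
  multilinear_identity mul alpha -> forall m, (0 < m)%N -> forall n,
  exists W : seq (seq 'I_l),
    [/\ uniq W, forall w, w \in W -> (size w <= n)%N /\ normal_word m d w &
      (Defs.dim (Rn n) <= size W)%N].
Proof.
have [s s_gen] := fg.
have [e [e_deg e_case R0]] : exists e : R, [/\ e \in Rn 0%N,
    is_unity mul e \/ e = 0 &
    forall x, x \in Rn 0%N -> exists a : K, x = a *: e].
  case: conn => [R0|[e [e1 _ R0]]].
    (* When the component of degree 0 vanishes, 0 serves as the value of the empty word. *)
    exists 0; split; [by apply/R0 | by right |].
    by move=> x /R0 ->; exists 0; rewrite scaler0.
  exists e; split; [|by left|by move=> x /R0].
  by apply/R0; exists 1; rewrite scale1r.
have [G [Gdeg Ggen]] := homog_generators s gr R0.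
exists (size G) => d alpha alpha0 lin m m_gt0 n.
pose q (i : 'I_(size G)) := nth (0%N, 0) G i.
have qG i : q i \in G by rewrite mem_nth.
apply: (@dim_le_normal_words _ _ mul alg _ (fun i => (q i).2) e _ _ alpha0 lin
  _ m_gt0 Rn (fun i => (q i).1)) => //.
- by move=> i; have [] := Gdeg _ (qG i).
- by move=> i; have [] := Gdeg _ (qG i).
move=> S Ssub Smul eS gS; apply: s_gen => //; apply: Ggen => // p pG.
have pi : (index p G < size G)%N by rewrite index_mem.
by have := gS (Ordinal pi); rewrite /q nth_index.
Qed.

Lemma hilbert_series_subexp : PI_algebra mul -> subexp (hilbert_series Rn).
Proof.
move=> /(PI_multilinear alg)[R0|[d [alpha [alpha0 lin]]]].
  apply: subexp_le (subexp_cst 0) _ => n; rewrite normr_nat lern0 -leqn0.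
  apply: (@dim_le_spanning _ _ _ 0 (fun=> 0)) => x _.
  by exists (fun=> 0); rewrite big_ord0.
have [l hl] := dim_le_normal_words_fg.
move=> rho rho1; have [s s1 s2] := exists_root_gt1 2 rho1.
have s0 : 0 < s by lra.
(* With [d.+1 <= s ^+ m] the exponential factor [d.+1 ^ (n %/ m)] is at most [s ^+ n]. A second
   [s ^+ n] absorbs the polynomial factor, and [s ^+ 2 <= rho]. *)
have [m0 hm0] := expr_unbounded d.+1%:R s1; pose m := m0.+1.
have [C [D hCD]] := @normal_words_count l m isT d.
have [B hB] := subexpM (subexp_cst C%:R) (subexpX D subexp_nat) s1.
exists B => n; rewrite normr_nat.
have [W [W_uniq W_normal dimW]] := hl d alpha alpha0 lin m isT n.
have := leq_trans dimW (hCD n W W_uniq W_normal).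
rewrite -(ler_nat rat) natrM natrM !natrX => /le_trans; apply.
apply: le_trans (_ : (B * s ^+ n) * s ^+ n <= _).
  apply: ler_pM => //; rewrite ?mulr_ge0 ?exprn_ge0 //.
    exact: le_trans (ler_norm _) (hB n).
  apply: le_trans (_ : s ^+ m ^+ (n %/ m) <= _).
    by apply: lerXn2r; rewrite ?nnegrE ?exprn_ge0 ?(ltW s0) // hm0.
  by rewrite -exprM mulnC; apply: ler_weXn2l; [rewrite ltW | apply: leq_divM].
rewrite -mulrA -exprMn -expr2; apply: ler_wpM2l.
  by have := hB 0%N; rewrite [s ^+ 0]expr0 [B * 1]mulr1; apply: le_trans.
by apply: lerXn2r => //; rewrite nnegrE ?sqr_ge0 //; lra.
Qed.
End HilbertGrowth.

Theorem theorem4p3 (K : fieldType) (R : lmodType K) (mul : R -> R -> R)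
    (Rn : nat -> {pred R}) :
  assoc_algebra mul ->
  grading mul Rn ->
  connected mul Rn ->
  finitely_generated mul ->
  PI_algebra mul ->
  rational_series (hilbert_series Rn) \/
  transcendental_series (hilbert_series Rn).
Proof.
move=> alg gr conn fg pi.
have [h_alg|] := pselect (algebraic_series (hilbert_series Rn)); last by right.
left; apply: fatou h_alg => [n|]; first exact: natr_int.
exact: hilbert_series_subexp pi.
Qed.
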